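(* Let $U\subset P(m)$ be a shifted order ideal. For any integer $t\ge 0$, the Stanley-Reisner ideal of the squeezed complex $\Delta_t(U)$ is $$I_{\Delta_t(U)}=\phi_t(I(U)).$$
   Context: Notation. $\mathbb{K}$ is a field, $m\ge 1$, $P(m)=\mathbb{K}[x_1,\ldots,x_m]$; $[n]=\{1,\ldots,n\}$ and $[a,b]=\{c\in\mathbb{N} : a\le c\le b\}$ (empty if $a>b$). Order ideals. A monomial order ideal of $P(m)$ is a finite set $U$ of monomials of $P(m)$ closed under taking divisors; it is always assumed that $1,x_1,\ldots,x_m\in U$. $U$ is shifted if $x_iu\in U$ ($u$ a monomial) and $i<j\le m$ imply $x_ju\in U$. $d_{\max}(U)$ is the maximal degree of a monomial in $U$. $I(U)$ is the monomial ideal of $P(m)$ generated by all monomials of $P(m)$ not in $U$. Squeezed complexes. Put $d=d_{\max}(U)$ and let $t\ge 0$ be an integer. For $u=x_{i_1}\cdots x_{i_s}\in U$ with $i_1\le\cdots\le i_s$ set $$F_t(u)=\bigcup_{\ell=1}^s\{i_\ell+2(\ell-1),\,i_\ell+2\ell-1\}\cup[m+2s+1,\,m+t+d]\quad\text{if } s\le t,$$ $$F_t(u)=\bigcup_{\ell=1}^t\{i_\ell+2(\ell-1),\,i_\ell+2\ell-1\}\cup\bigcup_{\ell=t+1}^s\{i_\ell+\ell+t-1\}\cup[m+t+s+1,\,m+t+d]\quad\text{if } s\ge t.$$ Each $F_t(u)$ is a $(d+t)$-subset of $[m+t+d]$. $\Delta_t(U)$ is the pure $(d+t-1)$-dimensional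 simplicial complex on vertex set $[m+t+d]$ whose facets are the sets $F_t(u)$, $u\in U$. Its Stanley-Reisner ideal $I_{\Delta_t(U)}$ is the ideal generated by the squarefree monomials $\prod_{i\in F}x_i$ with $F\subseteq[m+t+d]$, $F\notin\Delta_t(U)$. The map $\phi_t$. For an integer $t\ge0$ and a monomial $u=x_{i_1}\cdots x_{i_s}$ with $1\le i_1\le\cdots\le i_s$ in the variables $x_1,x_2,\ldots$, set $$\phi_t(u)=\prod_{k=1}^{\min\{t,s\}}x_{i_k+2(k-1)}\cdot\prod_{k=t+1}^{s}x_{i_k+k+t-1}$$ (the second product is empty if $s\le t$). For a monomial ideal $I$ with minimal set of monomial generators $G(I)$, $\phi_t(I)$ denotes the monomial ideal generated by $\{\phi_t(u) : u\in G(I)\}$. Both ideals in the claim are regarded as ideals generated by monomials in $\mathbb{K}[x_1,\ldots,x_{m+t+d}]$. *)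

(* Defs.v *)
From HB Require Import structures.
From mathcomp Require Import all_boot all_order all_algebra.
From mathcomp Require Import finmap zify.
From mathcomp.multinomials Require Import mpoly.

Set Implicit Arguments.
Unset Strict Implicit.
Unset Printing Implicit Defensive.

Import GRing.Theory.

(* The variable x_j (1 <= j <= n) is 'X_i with i = j - 1 : 'I_n.  All natural
   number indices and vertices below are 1-based; the shift to or from
   ordinals is made only in [indices], [facet] and [xmon].
   Ideals are predicates on the polynomial ring. *)

(** * Ideals *)

Definition ideal_gen (R : comNzRingType) (S : R -> Prop) (p : R) : Prop :=
  exists2 s : seq (R * R), (forall cg, cg \in s -> S cg.2)
    & p = (\sum_(cg <- s) cg.1 * cg.2)%R.

Definition monomial_ideal (K : fieldType) (n : nat)
    (G : 'X_{1..n} -> Prop) : {mpoly K[n]} -> Prop :=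
  ideal_gen (fun p => exists2 u, G u & p = 'X_[u]%R).

Definition minimal_monomial_generators (K : fieldType) (n : nat)
    (I : {mpoly K[n]} -> Prop) (G : 'X_{1..n} -> Prop) : Prop :=
  (forall p, monomial_ideal G p <-> I p) /\
  (forall G' : 'X_{1..n} -> Prop,
      (forall u, G' u -> G u) -> (forall p, monomial_ideal G' p <-> I p) ->
      forall u, G u -> G' u).

(* G(I).  A monomial ideal has exactly one inclusion-minimal set of monomial
   generators, so the existential only names that set. *)
Definition mingens (K : fieldType) (n : nat) (I : {mpoly K[n]} -> Prop)
    (u : 'X_{1..n}) : Prop :=
  exists2 G, minimal_monomial_generators I G & G u.

(** * Order ideals of monomials *)

(* (v <= u)%MM is divisibility of monomials, (v + u)%MM is their product. *)
Definition order_ideal (m : nat) (U : {fset 'X_{1..m}}) : Prop :=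
  [/\ forall u v : 'X_{1..m}, u \in U -> (v <= u)%MM -> v \in U,
      0%MM \in U
    & forall i : 'I_m, U_(i)%MM \in U].

Definition shifted (m : nat) (U : {fset 'X_{1..m}}) : Prop :=
  forall (u : 'X_{1..m}) (i j : 'I_m),
    i < j -> (U_(i) + u)%MM \in U -> (U_(j) + u)%MM \in U.

Definition dmax (m : nat) (U : {fset 'X_{1..m}}) : nat :=
  \max_(u <- U) mdeg u.

Definition IU (K : fieldType) (m : nat) (U : {fset 'X_{1..m}}) :
    {mpoly K[m]} -> Prop :=
  monomial_ideal (fun u => u \notin U).

(* The index sequence i_1 <= ... <= i_s of u = x_{i_1} ... x_{i_s}. *)
Definition indices (m : nat) (u : 'X_{1..m}) : seq nat :=
  flatten [seq nseq (u i) i.+1 | i : 'I_m <- enum 'I_m].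

(* i_l, for 1 <= l <= mdeg u. *)
Definition ix (m : nat) (u : 'X_{1..m}) (l : nat) : nat :=
  nth 0 (indices u) l.-1.

(** * Squeezed complexes *)

Definition facet_vertices (t m d : nat) (u : 'X_{1..m}) : seq nat :=
  let s := mdeg u in
  let pairs r :=
    flatten [seq [:: ix u l + 2 * (l - 1); ix u l + 2 * l - 1]
            | l <- index_iota 1 r.+1] in
  if s <= t then
    pairs s ++ index_iota (m + 2 * s + 1) (m + t + d).+1
  else
    pairs t ++ [seq ix u l + l + t - 1 | l <- index_iota t.+1 s.+1]
            ++ index_iota (m + t + s + 1) (m + t + d).+1.

(* For mdeg u <= d all of [facet_vertices t d u] lies in [1, m + t + d], so no
   vertex is lost in passing to ordinals. *)
Definition facet (t m d : nat) (u : 'X_{1..m}) : {set 'I_(m + t + d)} :=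
  [set j : 'I_(m + t + d) | j.+1 \in facet_vertices t d u].

Definition squeezed (t m : nat) (U : {fset 'X_{1..m}}) :
    {set {set 'I_(m + t + dmax U)}} :=
  [set F : {set 'I_(m + t + dmax U)} |
    has (fun u => F \subset facet t (dmax U) u) U].

Definition stanley_reisner (K : fieldType) (n : nat) (D : {set {set 'I_n}}) :
    {mpoly K[n]} -> Prop :=
  ideal_gen (fun p =>
    exists2 F : {set 'I_n}, F \notin D & p = (\prod_(i in F) 'X_i)%R).

(** * The map phi_t *)

(* x_j as a monomial in x_1, ..., x_N; meaningful for 1 <= j <= N, and the
   monomial 1 otherwise. *)
Definition xmon (N j : nat) : 'X_{1..N} := [multinom (i.+1 == j : nat) | i < N].

(* phi_t u, read in K[x_1, ..., x_N].  For N = m + t + d no variable of phi_t u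
   is out of range as soon as mdeg u <= d + 1 (see [mdeg_phi]), which holds for
   every u in G(I(U)) with d = d_max(U): a proper divisor of u lies in U. *)
Definition phi (t m N : nat) (u : 'X_{1..m}) : 'X_{1..N} :=
  let s := mdeg u in
  (\sum_(1 <= k < (minn t s).+1) xmon N (ix u k + 2 * (k - 1))
   + \sum_(t.+1 <= k < s.+1) xmon N (ix u k + k + t - 1))%MM.

Definition phi_ideal (K : fieldType) (t m N : nat) (I : {mpoly K[m]} -> Prop) :
    {mpoly K[N]} -> Prop :=
  monomial_ideal (fun w => exists2 u, mingens I u & w = phi t N u).

Lemma mdeg_xmon (N j : nat) : 0 < j <= N -> mdeg (xmon N j) = 1.
Proof.
case: j => // j /= ltjN; rewrite mdegE (bigD1 (Ordinal ltjN)) //= mnmE eqxx.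
rewrite big1 // => i neq; rewrite mnmE eqSS.
by move: neq; rewrite -val_eqE /= => /negPf->.
Qed.

Lemma size_indices (m : nat) (u : 'X_{1..m}) : size (indices u) = mdeg u.
Proof.
rewrite size_flatten /shape -map_comp sumnE big_map mdegE big_enum /=.
by apply: eq_bigr => i _; rewrite size_nseq.
Qed.

Lemma ix_bounds (m : nat) (u : 'X_{1..m}) (l : nat) :
  0 < l <= mdeg u -> 0 < ix u l <= m.
Proof.
case: l => // l; rewrite -size_indices /ix /= => ltl.
have /flattenP[s] := mem_nth 0 ltl.
by case/mapP=> i _ -> /nseqP[-> _] /=; rewrite ltn_ord.
Qed.

Lemma mdeg_phi (t m d : nat) (u : 'X_{1..m}) :
  mdeg u <= d.+1 -> mdeg (phi t (m + t + d) u) = mdeg u.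
Proof.
move=> le_ud; rewrite mdegD !mdeg_sum !big_nat.
rewrite (eq_bigr (fun=> 1)) => [|k hk]; last first.
  have : 0 < ix u k <= m by apply: ix_bounds; lia.
  by move=> hx; apply: mdeg_xmon; lia.
rewrite [X in _ + X](eq_bigr (fun=> 1)) => [|k hk]; last first.
  have : 0 < ix u k <= m by apply: ix_bounds; lia.
  by move=> hx; apply: mdeg_xmon; lia.
by rewrite -!big_nat !sum_nat_const_nat; lia.
Qed.

(* Main.v *)
Require Import Defs.
From mathcomp Require Import all_boot all_order all_algebra.
From mathcomp Require Import finmap zify.
From mathcomp.multinomials Require Import mpoly.

Set Implicit Arguments.
Unset Strict Implicit.
Unset Printing Implicit Defensive.

Import GRing.Theory.

(** Write a monomial as its weakly increasing index sequence i_0 <= i_1 <= ...,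
   numbered from 0, and call [spread t k i = i + k + min(k, t)] the place to
   which [phi] moves the k-th index i.  The support of phi_t(u) is then the set
   of the places a_k of u, and a facet F_t(v) is a union of blocks starting at
   the places b_k of v, of two vertices for k < t and of one vertex after that,
   completed by all vertices beyond the position that an index m would get after
   the last one ([facet_verticesP]).  Both ideals are generated by monomials, so
   the theorem reduces to two facts about divisibility.

   The monomials phi_t(u), u in G(I(U)), are supported on nonfaces.  Suppose
   that every a_k lies in F_t(v).  Consecutive places of u are too far apart to
   share a block of v, so the k-th place of u lies at or after the k-th block
   of v, and it is too small to lie in the completing part.  Hence deg u <= deg v
   and every index of u is at least the corresponding index of v
   ([phi_in_facet_dominates]).  Dropping the last indices of v and raising the
   others keeps v in a shifted order ideal ([shifted_dominated]), so v is not
   in U, as u is not.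

   Every nonface F contains the support of such a phi_t(u).  Read off F a
   sequence greedily: the next place is the least vertex of F lying in no block
   built so far.  If no such vertex remains, or if its index would exceed m,
   then F lies in the facet of the monomial built so far.  So, F being a nonface,
   the monomial must leave U at some step, and when it does for the first time
   it is a minimal generator: removing its last index gives the previous
   monomial, and removing another one gives a monomial obtained from the
   previous one by raising an index ([min_nonmember_rcons],
   [greedy_dichotomy]). *)

(** * Monomials as index sequences *)

Definition seqmon (N : nat) (s : seq nat) : 'X_{1..N} :=
  (\sum_(j <- s) xmon N j)%MM.

Lemma xmonE (N : nat) (i : 'I_N) : xmon N i.+1 = U_(i)%MM.
Proof.
by apply/mnmP=> j; rewrite mnmE mnm1E eqSS -val_eqE /= eq_sym.
Qed.

Lemma seqmonE (N : nat) (s : seq nat) (i : 'I_N) :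
  seqmon N s i = count_mem i.+1 s.
Proof.
rewrite /seqmon; elim: s => [|j s IH]; first by rewrite big_nil mnmE.
by rewrite big_cons mnmDE IH mnmE /= eq_sym.
Qed.

Lemma seqmon_perm (N : nat) (s r : seq nat) :
  perm_eq s r -> seqmon N s = seqmon N r.
Proof. exact: perm_big. Qed.

Lemma seqmon_cat (N : nat) (s r : seq nat) :
  seqmon N (s ++ r) = (seqmon N s + seqmon N r)%MM.
Proof. exact: big_cat. Qed.

Lemma seqmon_cons (N : nat) (i : 'I_N) (s : seq nat) :
  seqmon N (i.+1 :: s) = (U_(i) + seqmon N s)%MM.
Proof. by rewrite /seqmon big_cons xmonE. Qed.

Lemma count_indices (m : nat) (u : 'X_{1..m}) (i : 'I_m) :
  count_mem i.+1 (indices u) = u i.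
Proof.
rewrite /indices count_flatten -map_comp sumnE big_map big_enum /=.
rewrite (bigD1 i) //= count_nseq /= eqxx mul1n big1 ?addn0 // => j ji.
by rewrite count_nseq /= eqSS -[_ == _ :> nat]/(j == i) (negPf ji).
Qed.

Lemma indicesK (m : nat) (u : 'X_{1..m}) : seqmon m (indices u) = u.
Proof. by apply/mnmP=> i; rewrite seqmonE count_indices. Qed.

Lemma mem_indices (m : nat) (u : 'X_{1..m}) (x : nat) :
  x \in indices u -> 0 < x <= m.
Proof.
by case/flattenP=> s /mapP[i _ ->] /nseqP[-> _]; rewrite ltn_ord.
Qed.

Lemma sorted_indices (m : nat) (u : 'X_{1..m}) : sorted leq (indices u).
Proof.
rewrite (sorted_pairwise leq_trans) /indices.
have : pairwise ltn (map val (enum 'I_m)).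
  by rewrite val_enum_ord -(sorted_pairwise ltn_trans) iota_ltn_sorted.
elim: (enum 'I_m) => //= i e IH /andP[/allP lt_i /IH pw].
rewrite pairwise_cat pw andbT; apply/andP; split.
  apply/allrelP => x y /nseqP[-> _] /flattenP[r /mapP[j je ->] /nseqP[-> _]].
  by rewrite ltnS ltnW //; apply: lt_i; apply: map_f.
by elim: (u i) => //= n ->; rewrite andbT; apply/allP=> x /nseqP[-> _].
Qed.

Lemma seqmonK (m : nat) (s : seq nat) :
  sorted leq s -> {in s, forall x, 0 < x <= m} -> indices (seqmon m s) = s.
Proof.
move=> ss sm; apply: (sorted_eq leq_trans anti_leq) => //.
  exact: sorted_indices.
apply/allP => x /=; rewrite mem_cat => xs; have {xs} : 0 < x <= m.
  by case/orP: xs => [/mem_indices|/sm].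
by case: x => //= x xm; rewrite (count_indices _ (Ordinal xm)) seqmonE.
Qed.

Lemma mdeg_seqmon (m : nat) (s : seq nat) :
  {in s, forall x, 0 < x <= m} -> mdeg (seqmon m s) = size s.
Proof.
elim: s => [|x s IH] sm; first by rewrite /seqmon big_nil mdeg0.
rewrite /seqmon big_cons mdegD mdeg_xmon ?sm ?mem_head // IH // => y ys.
by apply: sm; rewrite inE ys orbT.
Qed.

(** * Shifted order ideals *)

Lemma shifted_le (m : nat) (U : {fset 'X_{1..m}}) (a b : nat) (s : seq nat) :
  shifted U -> 0 < a <= m -> 0 < b <= m -> a <= b ->
  seqmon m (a :: s) \in U -> seqmon m (b :: s) \in U.
Proof.
case: a b => // a [] // b shU am bm; rewrite ltnS leq_eqVlt.
case/orP=> [/eqP->//|ab].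
rewrite (seqmon_cons (Ordinal am)) (seqmon_cons (Ordinal bm)).
exact: shU.
Qed.

(** The order in which the factors of a monomial are listed does not matter for
   [seqmon], so the indices of r can be replaced one at a time by those of s,
   without the intermediate sequences being sorted. *)
Lemma shifted_dominated (m : nat) (U : {fset 'X_{1..m}}) (r s : seq nat) :
  order_ideal U -> shifted U ->
  {in r, forall x, 0 < x <= m} -> {in s, forall x, 0 < x <= m} ->
  size s <= size r ->
  (forall k, k < size s -> nth 0 r k <= nth 0 s k) ->
  seqmon m r \in U -> seqmon m s \in U.
Proof.
move=> [dvdU _ _] shU; move: s r.
(* The prefix p holds the indices that have already been raised. *)
have step s r p : {in r, forall x, 0 < x <= m} ->
    {in s, forall x, 0 < x <= m} -> size s <= size r ->
    (forall k, k < size s -> nth 0 r k <= nth 0 s k) ->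
    seqmon m (p ++ r) \in U -> seqmon m (p ++ s) \in U.
  elim: s r p => [|y s IH] r p rm sm.
    move=> _ _ /dvdU; apply; rewrite cats0 seqmon_cat; apply/mnm_lepP=> i.
    by rewrite mnmDE leq_addr.
  case: r rm => //= x r rm szr le_rs.
  have zE z q : seqmon m (p ++ z :: q) = seqmon m (z :: p ++ q).
    by apply: seqmon_perm; rewrite perm_catC /= perm_cons perm_catC.
  rewrite zE => xU.
  rewrite -cat_rcons; apply: (IH r) => // [z zr|z zs|k ks|].
  - by apply: rm; rewrite inE zr orbT.
  - by apply: sm; rewrite inE zs orbT.
  - exact: (le_rs k.+1).
  - rewrite cat_rcons zE; apply: (shifted_le shU _ _ (le_rs 0 _) xU) => //.
      by rewrite rm ?mem_head.
    by rewrite sm ?mem_head.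
by move=> s r; apply: (step s r [::]).
Qed.

(** * Monomial ideals *)

Lemma ideal_gen_sub (R : comNzRingType) (S T : R -> Prop) :
  (forall p, S p -> exists c q, T q /\ p = (c * q)%R) ->
  forall p, ideal_gen S p -> ideal_gen T p.
Proof.
move=> ST p [s]; elim: s p => [|[c g] s IH] p sS ->.
  by exists [::]; rewrite ?big_nil.
have [cg cgs|r rT rE] := IH _ _ (erefl _).
  by apply: sS; rewrite inE cgs orbT.
have [|c' [q [Tq gE]]] := ST g; first exact: (sS (c, g) (mem_head _ _)).
exists ((c * c', q)%R :: r) => [cg|]; last by rewrite !big_cons /= rE gE mulrA.
by rewrite inE => /orP[/eqP->|/rT].
Qed.

Lemma monomial_ideal_sub (K : fieldType) (n : nat) (G H : 'X_{1..n} -> Prop) :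
  (forall u, G u -> exists2 v, H v & (v <= u)%MM) ->
  forall p : {mpoly K[n]}, monomial_ideal G p -> monomial_ideal H p.
Proof.
move=> GH; apply: ideal_gen_sub => _ [u /GH[v Hv vu] ->].
exists 'X_[(u - v)%MM]%R, 'X_[v]%R; split; first by exists v.
by rewrite -mpolyXD submK.
Qed.

Lemma monomial_idealX (K : fieldType) (n : nat) (G : 'X_{1..n} -> Prop) u :
  G u -> monomial_ideal G ('X_[u] : {mpoly K[n]})%R.
Proof.
move=> Gu; exists [:: (1, 'X_[u])%R]; last by rewrite big_seq1 mul1r.
by move=> cg; rewrite inE => /eqP->; exists u.
Qed.

(** A monomial with nonzero coefficient in a combination of generators already
   occurs in one of its terms. *)
Lemma monomial_ideal_dvd (K : fieldType) (n : nat) (G : 'X_{1..n} -> Prop) u :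
  monomial_ideal G ('X_[u] : {mpoly K[n]})%R -> exists2 v, G v & (v <= u)%MM.
Proof.
case=> s sG uE; have : u \in msupp ('X_[u] : {mpoly K[n]})%R.
  by rewrite msuppX mem_head.
rewrite uE; elim: s sG {uE} => [|[c g] s IH] sG.
  by rewrite big_nil msupp0.
rewrite big_cons => /msuppD_le; rewrite mem_cat => /orP[|]; last first.
  by apply: IH => cg cgs; apply: sG; rewrite inE cgs orbT.
have [v Gv /= ->] := sG _ (mem_head _ _).
rewrite (perm_mem (msuppMX _ _)) => /mapP[w _ ->].
by exists v => //; rewrite lem_addr.
Qed.

(** The exponents of the minimal monomial generators of I(U), see
   [mingens_IU]; this form speaks of U alone. *)
Definition min_nonmember (m : nat) (U : {fset 'X_{1..m}}) (u : 'X_{1..m}) :=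
  u \notin U /\ forall v : 'X_{1..m}, (v <= u)%MM -> v != u -> v \in U.

Lemma min_nonmemberP (m : nat) (U : {fset 'X_{1..m}}) (u : 'X_{1..m}) :
  order_ideal U -> u \notin U ->
  (forall i : 'I_m, u i != 0 -> (u - U_(i))%MM \in U) -> min_nonmember U u.
Proof.
move=> [dvdU _ _] uU predU; split=> // v vu; move=> v_neq_u.
have /existsP[i] : [exists i, v i < u i].
  apply: contraNT v_neq_u => /existsPn vi; apply/eqP/mnmP=> i.
  by apply/eqP; rewrite eqn_leq (mnm_lepP vu) leqNgt vi.
move=> vi; apply: (dvdU _ _ (predU i _)); first by rewrite -lt0n (leq_trans _ vi).
apply/mnm_lepP => j; rewrite mnmBE mnm1E.
by have [<-|_] := eqVneq i j; [lia | rewrite subn0 (mnm_lepP vu)].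
Qed.

Lemma min_nonmember_dvd (m : nat) (U : {fset 'X_{1..m}}) (u : 'X_{1..m}) :
  order_ideal U -> u \notin U -> exists2 v, min_nonmember U v & (v <= u)%MM.
Proof.
move=> oiU; have [n] := ubnP (mdeg u); elim: n u => // n IH u un uU.
have [/forallP minu|] := boolP [forall i, (u i != 0) ==> ((u - U_(i))%MM \in U)].
  by exists u; [|exact: lepm_refl]; apply: min_nonmemberP => // i; apply/implyP.
case/forallPn=> i; rewrite negb_imply => /andP[ui uiU].
have le_ui : (U_(i) <= u)%MM by rewrite lep1mP.
case: (IH (u - U_(i))%MM) => // [|v minv vu].
  by move: un; rewrite -{1}(submK le_ui) mdegD mdeg1 addn1.
by exists v => //; apply: lepm_trans vu (lem_subr _ _).
Qed.

Lemma IU_min_nonmember (K : fieldType) (m : nat) (U : {fset 'X_{1..m}}) :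
  order_ideal U ->
  forall p : {mpoly K[m]}, monomial_ideal (min_nonmember U) p <-> IU U p.
Proof.
move=> oiU p; split; apply: monomial_ideal_sub => u.
  by case=> uU _; exists u => //; apply: lepm_refl.
exact: min_nonmember_dvd.
Qed.

(** Any set of monomials generating I(U) contains each minimal nonmember u of U:
   a generator dividing u is outside U, hence equal to u.  As the minimal
   nonmembers generate I(U), they form its only minimal generating set. *)
Lemma mingens_IU (K : fieldType) (m : nat) (U : {fset 'X_{1..m}}) u :
  order_ideal U -> mingens (IU (K := K) U) u <-> min_nonmember U u.
Proof.
move=> oiU; have genU := @IU_min_nonmember K m U oiU.
have sub_gen (G : 'X_{1..m} -> Prop) : (forall w, G w -> w \notin U) ->
    (forall p : {mpoly K[m]}, monomial_ideal G p <-> IU U p) ->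
    forall v, min_nonmember U v -> G v.
  move=> GU genG v minv.
  have [|w Gw wv] := @monomial_ideal_dvd K m G v.
    by apply/genG/genU/monomial_idealX.
  have [<-//|wNv] := eqVneq w v.
  by move: (GU w Gw); rewrite minv.2.
split=> [[G [genG minG] Gu]|minu].
  have GU w : G w -> w \notin U.
    move=> Gw; have [|v vU vw] := @monomial_ideal_dvd K m (fun u => u \notin U) w.
      exact/genG/monomial_idealX.
    by apply: contra vU => wU; case: oiU => dvdU _ _; apply: dvdU vw.
  by apply: (minG (min_nonmember U)) => // v; apply: sub_gen.
exists (min_nonmember U) => //; split=> // G GU genG v minv.
by apply: sub_gen minv => // w /GU[].
Qed.

Lemma mdeg_dmax (m : nat) (U : {fset 'X_{1..m}}) (u : 'X_{1..m}) :
  u \in U -> mdeg u <= dmax U.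
Proof. by move=> uU; rewrite /dmax (big_rem u) //= leq_maxl. Qed.

(** This bound keeps phi_t(u) within the variables x_1, ..., x_(m+t+d), so that no
   factor of it is lost. *)
Lemma mdeg_min_nonmember (m : nat) (U : {fset 'X_{1..m}}) u :
  order_ideal U -> min_nonmember U u -> mdeg u <= (dmax U).+1.
Proof.
case=> _ U0 _ [uU minu]; have [i ui|u0] := pickP (fun i => u i != 0); last first.
  have uE : u = 0%MM by apply/mnmP=> i; rewrite mnm0E; apply/eqP/negbFE/u0.
  by rewrite uE U0 in uU.
have le_ui : (U_(i) <= u)%MM by rewrite lep1mP.
have degE : mdeg u = (mdeg (u - U_(i))).+1.
  by rewrite -{1}(submK le_ui) mdegD mdeg1 addn1.
rewrite degE ltnS; apply: mdeg_dmax; apply: minu; first exact: lem_subr.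
by apply/eqP=> /(congr1 (@mdeg m)); rewrite degE; lia.
Qed.

(** * Spreading index sequences *)

Definition spread (t k i : nat) : nat := i + k + minn k t.

Definition spread_seq (t : nat) (s : seq nat) : seq nat :=
  [seq spread t k (nth 0 s k) | k <- iota 0 (size s)].

(** The summand [k < t] is the length of the k-th block minus one: places with
   increasing numbers and weakly increasing indices lie in disjoint blocks. *)
Lemma spread_ltn (t k l i j : nat) :
  k < l -> i <= j -> spread t k i + (k < t) < spread t l j.
Proof. rewrite /spread; lia. Qed.

Lemma nth_sorted (s : seq nat) (k l : nat) :
  sorted leq s -> k <= l -> l < size s -> nth 0 s k <= nth 0 s l.
Proof.
move=> ss kl ls; apply: (sorted_leq_nth leq_trans leqnn) => //.
by rewrite inE (leq_ltn_trans kl).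
Qed.

Lemma spread_seq_uniq (t : nat) (s : seq nat) :
  sorted leq s -> uniq (spread_seq t s).
Proof.
move=> ss; rewrite map_inj_in_uniq ?iota_uniq // => k l.
rewrite !mem_iota !add0n /= => ks ls e.
have := nth_sorted ss; case: (ltngtP k l) => // kl /(_ _ _ (ltnW kl)).
  by move=> /(_ ls) /(spread_ltn t kl); lia.
by move=> /(_ ks) /(spread_ltn t kl); lia.
Qed.

(** One formula for both products in the definition of phi_t. *)
Lemma phiE (t m N : nat) (u : 'X_{1..m}) :
  phi t N u = seqmon N (spread_seq t (indices u)).
Proof.
rewrite /seqmon big_map size_indices /phi.
have -> : iota 0 (mdeg u) = index_iota 0 (mdeg u) by rewrite /index_iota subn0.
set s := mdeg u; pose F k := xmon N (spread t k (ix u k.+1)).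
rewrite -[RHS]/(\sum_(0 <= k < s) F k)%MM.
rewrite [RHS](big_cat_nat (n := minn t s)) ?geq_minr //=.
rewrite !big_add1 /=; congr (_ + _)%MM.
  apply: eq_big_nat => k hk; congr xmon; rewrite /spread; lia.
(* For s < t the two bounds differ, but both sums are empty. *)
have -> : (\sum_(minn t s <= k < s) F k = \sum_(t <= k < s) F k)%MM.
  by have [//|st] := leqP t s; rewrite !big_geq // ltnW.
apply: eq_big_nat => k hk; congr xmon; rewrite /spread; lia.
Qed.

(** * Facets *)

(** The cases s <= t and s >= t of the definition of a facet agree: the vertices
   completing it are those beyond [spread t s m]. *)
Lemma facet_verticesP (t m d : nat) (u : 'X_{1..m}) (x : nat) :
  x <= m + t + d ->
  reflect ((exists2 k, k < mdeg u &
              spread t k (ix u k.+1) <= x <= spread t k (ix u k.+1) + (k < t))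
           \/ spread t (mdeg u) m < x)
          (x \in facet_vertices t d u).
Proof.
move=> xN; apply: (iffP idP); rewrite /facet_vertices.
  case: ifP => st; rewrite !mem_cat !mem_index_iota.
    case/orP=> [/flattenP[r /mapP[l]]|]; last by rewrite /spread; lia.
    rewrite mem_index_iota => ls -> xr; left; exists l.-1; first by lia.
    have -> : l.-1.+1 = l by lia.
    by move: xr; rewrite !inE /spread; lia.
  case/or3P=> [/flattenP[r /mapP[l]]|/mapP[l]|]; last by rewrite /spread; lia.
    rewrite mem_index_iota => ls -> xr; left; exists l.-1; first by lia.
    have -> : l.-1.+1 = l by lia.
    by move: xr; rewrite !inE /spread; lia.
  rewrite mem_index_iota => ls ->; left; exists l.-1; first by lia.
  have -> : l.-1.+1 = l by lia.
  by rewrite /spread; lia.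
case=> [[k ks xk]|xs]; last first.
  by case: ifP => st; rewrite !mem_cat !mem_index_iota /spread in xs *;
    apply/orP; right; rewrite ?orbT //; try (apply/orP; right); lia.
have pairP r : k < r -> k < t -> x \in flatten
   [seq [:: ix u l + 2 * (l - 1); ix u l + 2 * l - 1] | l <- index_iota 1 r.+1].
  move=> kr kt; apply/flattenP.
  exists [:: ix u k.+1 + 2 * (k.+1 - 1); ix u k.+1 + 2 * k.+1 - 1].
    by apply: map_f; rewrite mem_index_iota.
  by move: xk; rewrite !inE /spread; lia.
case: ifP => st; rewrite !mem_cat.
  by rewrite pairP // (leq_trans ks).
have [kt|tk] := ltnP k t; first by rewrite pairP.
apply/or3P/Or32/mapP; exists k.+1; first by rewrite mem_index_iota; lia.
by move: xk; rewrite /spread; lia.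
Qed.

(** If the k-th place of u lies beyond the blocks of v numbered below k, then it
   lies in a later block, hence at or after the k-th one: the completing vertices
   are out of reach as long as k is at most the degree of v.  The next place of u
   is then beyond the k-th block, and the argument repeats. *)
Lemma phi_in_facet_dominates (t m d : nat) (u v : 'X_{1..m}) :
  mdeg u <= d.+1 ->
  (forall i, 0 < phi t (m + t + d) u i -> i \in facet t d v) ->
  mdeg u <= mdeg v /\ forall k, k < mdeg u -> ix v k.+1 <= ix u k.+1.
Proof.
move=> ud uF.
have in_facet k : k < mdeg u ->
    0 < ix u k.+1 <= m /\ spread t k (ix u k.+1) \in facet_vertices t d v.
  move=> ku; have uk : 0 < ix u k.+1 <= m by apply: ix_bounds.
  split=> //; set x := spread t k _.
  have [j xE jN] : exists2 j, x = j.+1 & j < m + t + d.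
    by exists x.-1; rewrite /x /spread; lia.
  have := uF (Ordinal jN); rewrite inE /= -xE; apply.
  rewrite phiE seqmonE /= -xE -has_count has_pred1.
  by apply/mapP; exists k => //; rewrite mem_iota size_indices.
suff dom : forall k, k < mdeg u ->
    k < mdeg v /\ spread t k (ix v k.+1) <= spread t k (ix u k.+1).
  split=> [|k /dom[_]]; last by rewrite /spread; lia.
  by case: (mdeg u) dom => // n /(_ n (ltnSn n))[].
have le_ix k l : k <= l -> l < mdeg v -> ix v k.+1 <= ix v l.+1.
  by move=> kl lv; apply: nth_sorted (sorted_indices v) kl _; rewrite size_indices.
(* Places are compared rather than indices, as this is what the membership in a
   block provides. *)
have step k : k < mdeg u ->
    (forall l, l < k -> l < mdeg v /\
       spread t l (ix v l.+1) + (l < t) < spread t k (ix u k.+1)) ->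
    k < mdeg v /\ spread t k (ix v k.+1) <= spread t k (ix u k.+1).
  move=> ku below; have [uk] := in_facet k ku.
  case/facet_verticesP=> [|[l lv /andP[vl lu]]|vu]; first by rewrite /spread; lia.
    have [/below[_]|kl] := ltnP l k; first by lia.
    split; first exact: leq_ltn_trans lv.
    by apply: leq_trans vl; have := le_ix k l kl lv; rewrite /spread; lia.
  have vk : mdeg v < k by move: vu; rewrite /spread; lia.
  by have [] := below _ vk; rewrite ltnn.
have ix_u k l : k <= l -> l < mdeg u -> ix u k.+1 <= ix u l.+1.
  by move=> kl lv; apply: nth_sorted (sorted_indices u) kl _; rewrite size_indices.
elim/ltn_ind=> k IH ku; apply: step => // l lk.
have [lv vl] := IH l lk (ltn_trans lk ku); split=> //.
by have := spread_ltn t lk (ix_u l k (ltnW lk) ku); lia.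
Qed.

(** * The greedy sequence *)

(** Membership in one of the blocks that s contributes to its facet. *)
Definition covered (t : nat) (s : seq nat) (x : nat) : bool :=
  has (fun k => spread t k (nth 0 s k) <= x <= spread t k (nth 0 s k) + (k < t))
      (iota 0 (size s)).

Lemma iota0_rcons (n : nat) : iota 0 n.+1 = rcons (iota 0 n) n.
Proof. by rewrite -addn1 iotaD add0n cats1. Qed.

Lemma spread_seq_rcons (t : nat) (s : seq nat) (i : nat) :
  spread_seq t (rcons s i) = rcons (spread_seq t s) (spread t (size s) i).
Proof.
rewrite /spread_seq size_rcons iota0_rcons map_rcons nth_rcons ltnn eqxx.
congr rcons; apply/eq_in_map => k; rewrite mem_iota add0n /= => ks.
by rewrite nth_rcons ks.
Qed.

Lemma covered_rcons (t : nat) (s : seq nat) (i x : nat) :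
  covered t (rcons s i) x =
  covered t s x
  || (spread t (size s) i <= x <= spread t (size s) i + (size s < t)).
Proof.
rewrite /covered size_rcons iota0_rcons has_rcons nth_rcons ltnn eqxx orbC.
congr orb; apply: eq_in_has => k; rewrite mem_iota add0n /= => ks.
by rewrite nth_rcons ks.
Qed.

Lemma sub_facet_vertices (t m d : nat) (s A : seq nat) :
  sorted leq s -> {in s, forall i, 0 < i <= m} ->
  {in A, forall x, x <= m + t + d} ->
  {in A, forall x, covered t s x \/ spread t (size s) m < x} ->
  {subset A <= facet_vertices t d (seqmon m s)}.
Proof.
move=> ss sm AN cov x xA; apply/facet_verticesP; first exact: AN.
rewrite mdeg_seqmon //; case: (cov x xA) => [/hasP[k]|]; last by right.
rewrite mem_iota add0n => ks kx; left; exists k => //.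
by rewrite /ix seqmonK.
Qed.

(** Removing an index j < i from s followed by i leaves s with j raised to i, which
   is still in U by shiftedness. *)
Lemma min_nonmember_rcons (m : nat) (U : {fset 'X_{1..m}}) s i :
  order_ideal U -> shifted U -> {in s, forall j, 0 < j <= i} -> 0 < i <= m ->
  seqmon m s \in U -> seqmon m (rcons s i) \notin U ->
  min_nonmember U (seqmon m (rcons s i)).
Proof.
move=> oiU shU si im sU siU; apply: min_nonmemberP => // j.
rewrite seqmonE -lt0n -has_count has_pred1 mem_rcons inE.
have remE r : perm_eq (rcons s i) (j.+1 :: r) ->
    (seqmon m (rcons s i) - U_(j))%MM = seqmon m r.
  by move=> /seqmon_perm ->; rewrite seqmon_cons addmC addmK.
case/orP=> [/eqP ji|js].
  by rewrite (remE s) // perm_rcons ji.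
rewrite (remE (i :: rem j.+1 s)); last first.
  rewrite perm_rcons (perm_trans (y := i :: j.+1 :: rem j.+1 s)) //.
    by rewrite perm_cons perm_to_rem.
  by rewrite (perm_catCA [:: i] [:: j.+1]).
have /andP[_ ji] := si _ js.
apply: (shifted_le shU _ im ji); first exact: ltn_ord.
by rewrite -(seqmon_perm _ (perm_to_rem js)).
Qed.

(** The induction carries a sequence s whose places are in A and whose monomial is
   in U, such that every vertex of A is in a block of s or at least the place
   that the last index of s would get if it were repeated.  The second
   alternative makes the sequence weakly increasing when it is extended by the
   least uncovered vertex.  The length of s is the degree of a member of U, hence
   at most d_max(U), so the process ends. *)
Lemma greedy_dichotomy (m t : nat) (U : {fset 'X_{1..m}}) (A : seq nat) :
  order_ideal U -> shifted U ->
  {in A, forall x, 0 < x <= m + t + dmax U} ->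
  (exists2 u, u \in U & {subset A <= facet_vertices t (dmax U) u}) \/
  (exists2 u, min_nonmember U u & {subset spread_seq t (indices u) <= A}).
Proof.
move=> oiU shU AN.
have AN' : {in A, forall x, x <= m + t + dmax U} by move=> x /AN/andP[].
set concl := (_ \/ _).
(* The default 1 stands for the last index of the empty sequence: every vertex is
   at least [spread t 0 1], which is 1. *)
suff step n s : (dmax U).+1 - size s < n -> sorted leq s ->
    {in s, forall i, 0 < i <= m} -> seqmon m s \in U ->
    {subset spread_seq t s <= A} ->
    {in A, forall x, covered t s x \/ spread t (size s) (last 1 s) <= x} ->
    concl.
  apply: (step _ [::] (ltnSn _)) => // [|x /AN/andP[x0 _]].
    by rewrite /seqmon big_nil; case: oiU.
  by right; rewrite /spread /=; lia.
elim: n s => // n IH s sn ss sm sU sA cov.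
have [Acov|] := boolP (all (covered t s) A).
  left; exists (seqmon m s) => //; apply: sub_facet_vertices => // x xA.
  by left; apply: (allP Acov).
rewrite -has_predC => /hasP unc.
have {unc} : exists x, (x \in A) && ~~ covered t s x.
  by case: unc => x xA xs; exists x; rewrite xA.
case/ex_minnP=> x /andP[xA xs] minx.
have [i xE si] : exists2 i, x = spread t (size s) i & last 1 s <= i.
  exists (x - size s - minn (size s) t).
    by case: (cov x xA) => [/(negP xs)//|]; rewrite /spread; lia.
  by case: (cov x xA) => [/(negP xs)//|]; rewrite /spread; lia.
have le_last j : j \in s -> j <= last 1 s.
  move=> js; rewrite -nth_last (set_nth_default 0); last first.
    by case: (s) js => //= *; apply: leqnn.
  rewrite -{1}(nth_index 0 js); apply: nth_sorted => //; last first.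
    by case: (s) js => //= *; apply: leqnn.
  by move: js; rewrite -index_mem => js; rewrite -ltnS (ltn_predK js).
(* A vertex x that is too large to be the place of an index at most m is one of
   the completing vertices, and so are all larger ones. *)
have [im|mi] := leqP i m; last first.
  left; exists (seqmon m s) => //; apply: sub_facet_vertices => // y yA.
  have [|ys] := boolP (covered t s y); [by left | right].
  by have := minx y; rewrite yA ys => /(_ isT); rewrite xE /spread; lia.
have i_gt0 : 0 < i.
  apply: leq_trans si; case: (lastP s) sm => // r j rm.
  rewrite last_rcons; have := rm j.
  by rewrite mem_rcons mem_head => /(_ isT)/andP[].
have ssi : sorted leq (rcons s i).
  by case: (s) ss si => //= a r; rewrite rcons_path => ->.
have smi : {in rcons s i, forall j, 0 < j <= m}.
  by move=> j; rewrite mem_rcons inE => /orP[/eqP->|/sm//]; rewrite i_gt0.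
have sAi : {subset spread_seq t (rcons s i) <= A}.
  by move=> y; rewrite spread_seq_rcons mem_rcons inE -xE => /orP[/eqP->|/sA].
have [siU|siU] := boolP (seqmon m (rcons s i) \in U); last first.
  right; exists (seqmon m (rcons s i)); last by rewrite seqmonK.
  apply: min_nonmember_rcons; rewrite ?i_gt0 // => j js.
  by case/andP: (sm j js) => -> _; apply: leq_trans (le_last j js) si.
apply: (IH (rcons s i)) => //.
  have := mdeg_dmax sU; rewrite mdeg_seqmon // size_rcons; lia.
move=> y yA; rewrite covered_rcons.
have [|ys] /= := boolP (covered t s y); first by left.
have := minx y; rewrite yA ys size_rcons last_rcons => /(_ isT).
rewrite xE => xy.
by have [yx|yx] := leqP y (spread t (size s) i + (size s < t));
  [left | right]; move: yx xy; rewrite /spread; lia.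
Qed.


Theorem theorem3p15 (K : fieldType) (m : nat) (U : {fset 'X_{1..m}}) (t : nat)
    (m_gt0 : 0 < m) (oiU : order_ideal U) (shU : shifted U) :
  forall p : {mpoly K[m + t + dmax U]},
    stanley_reisner (squeezed t U) p <->
    phi_ideal t (IU (K := K) U) p.
Proof.
move=> p; split; apply: ideal_gen_sub => {}p.
  case=> F FU ->; rewrite mprodXE.
  pose A := [seq (val i).+1 | i <- enum F].
  have AE (i : 'I_(m + t + dmax U)) : (i.+1 \in A) = (i \in F).
    by rewrite (mem_map (inj_comp succn_inj val_inj)) mem_enum.
  have [|[v vU Av]|[u minu uA]] := @greedy_dichotomy m t U A oiU shU.
  - by move=> _ /mapP[i _ ->] /=.
  - case/negP: FU; rewrite inE; apply/hasP; exists v => //.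
    by apply/subsetP=> i iF; rewrite inE Av ?AE.
  (* The places of u are distinct, so phi_t(u) is squarefree. *)
  have uF : (phi t (m + t + dmax U) u <= \sum_(i in F) U_(i))%MM.
    apply/mnm_lepP=> i; rewrite phiE seqmonE mnm_sumE.
    rewrite count_uniq_mem ?spread_seq_uniq ?sorted_indices //.
    case: (boolP (_ \in _)) => // /uA; rewrite AE => iF.
    by rewrite (bigD1 i) //= mnm1E eqxx.
  exists 'X_[(\sum_(i in F) U_(i) - phi t _ u)%MM]%R, 'X_[phi t _ u]%R.
  rewrite -mpolyXD submK //; split=> //; exists (phi t _ u) => //.
  by exists u => //; apply/mingens_IU.
case=> _ [u /(mingens_IU _ _ oiU) minu ->] ->.
set w := phi _ _ _; pose F := [set i | 0 < w i].
have Fw : (\sum_(i in F) U_(i) <= w)%MM.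
  apply/mnm_lepP=> i; rewrite mnm_sumE; have [iF|iF] := boolP (i \in F).
    rewrite (bigD1 i) //= big1 => [|j /andP[_ ji]]; rewrite mnm1E ?(negPf ji) //.
    by rewrite eqxx addn0; rewrite inE in iF.
  rewrite big1 // => j jF; rewrite mnm1E; case: eqP => // ji.
  by rewrite -ji jF in iF.
exists 'X_[(w - \sum_(i in F) U_(i))%MM]%R, 'X_[\sum_(i in F) U_(i)]%R.
rewrite -mpolyXD submK //; split=> //; exists F; last by rewrite mprodXE.
rewrite inE; apply/hasPn=> v vU; apply/negP=> /subsetP Fv.
have le_ud := mdeg_min_nonmember oiU minu.
have [|uv dom] := @phi_in_facet_dominates t m (dmax U) u v le_ud.
  by move=> i wi; apply: Fv; rewrite inE.
case/negP: minu.1; rewrite -(indicesK u).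
apply: (shifted_dominated oiU shU (r := indices v)); rewrite ?size_indices //.
- by move=> x /mem_indices.
- by move=> x /mem_indices.
- by rewrite indicesK.
Qed.
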